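(* Let $\Gamma=(P,\mathcal{L})$ be a non-degenerate polar space of finite polar rank $\mathrm{prk}(\Gamma)\geq 2$, all of whose lines have at least three points. Suppose that $\Gamma$ admits a faithful embedding. Then $$\mathrm{crk}(\Gamma)=\mathrm{crk}_{\mathrm{WO}}(\Gamma).$$ Moreover, every member of $\mathfrak{W}_{\mathrm{nice}}(\Gamma)$ is contained in a maximal member of $\mathfrak{W}_{\mathrm{nice}}(\Gamma)$, and all maximal members of $\mathfrak{W}_{\mathrm{nice}}(\Gamma)$ have length $\mathrm{crk}(\Gamma)$.
   Context: A point-line geometry is a pair $\Gamma=(P,\mathcal{L})$ where $P$ (points) is a non-empty set and $\mathcal{L}$ (lines) is a family of subsets of $P$, each containing at least two points. A subspace is a subset $S\subseteq P$ such that every line meeting $S$ in at least two points is contained in $S$; for $X\subseteq P$, $\langle X\rangle$ is the smallest subspace containing $X$. The generating rank is $\mathrm{rk}_{\mathrm{gen}}(\Gamma):=\min\{|X| : X\subseteq P,\ \langle X\rangle=P\}$. Two points are collinear if they are equal or lie on a common line. A polar space is a point-line geometry in which, for every point $p$ and every line $\ell$, $p$ is collinear with either exactly one or all points of $\ell$; it is non-degenerate if no point is collinear with all points. A subspace is singular if its points are pairwise collinear; singular subspaces of non-degenerate polar spaces are projective spaces. The polar rank $\mathrm{prk}(\Gamma)$ is the supremum of the (generating) ranks of the singular subspaces of $\Gamma$; when finite, all maximal singular subspaces have rank $\mathrm{prk}(\Gamma)$. The generating rank $\mathrm{rk}_{\mathrm{gen}}(\Gamma)$ may be infinite. A (projective)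 embedding of $\Gamma$ is an injective map $e$ from $P$ to the set of points of $\mathrm{PG}(V)$, for a vector space $V$ over a division ring, such that $e(\ell)=\{e(x):x\in\ell\}$ is a line of $\mathrm{PG}(V)$ for every $\ell\in\mathcal{L}$ and $e(P)$ spans $\mathrm{PG}(V)$. For $X\subseteq P$, $[e(X)]$ denotes the span of $e(X)$ in $\mathrm{PG}(V)$. A subspace of $\Gamma$ is nice if it contains two mutually disjoint maximal singular subspaces of $\Gamma$. The embedding $e$ is faithful if $S=e^{-1}([e(S)])$ for every nice subspace $S$ of $\Gamma$. If $\Gamma$ admits an embedding then $\mathrm{rk}_{\mathrm{gen}}(\Gamma)\geq 2\cdot\mathrm{prk}(\Gamma)$; the polar corank $\mathrm{crk}(\Gamma)$ is the unique cardinal $\mathfrak{r}$ with $\mathrm{rk}_{\mathrm{gen}}(\Gamma)=\mathfrak{r}+2\cdot\mathrm{prk}(\Gamma)$. A chain of nice subspaces is a (non-empty) set $\mathcal{C}$ of nice subspaces totally ordered by inclusion; its length is $\ell(\mathcal{C}):=|\mathcal{C}|-1$, with $|\mathcal{C}|-1=|\mathcal{C}|$ if $|\mathcal{C}|$ is infinite. $\mathfrak{W}_{\mathrm{nice}}(\Gamma)$ is the family of chains of nice subspaces of $\Gamma$ that are well ordered by inclusion (maximality in it is with respect to inclusion of chains), and $\mathrm{crk}_{\mathrm{WO}}(\Gamma):=\sup\{\ell(\mathcal{C}) : \mathcal{C}\in\mathfrak{W}_{\mathrm{nice}}(\Gamma)\}$. *)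

(* Defs.v *)
From mathcomp Require Import all_boot ssralg.
From mathcomp Require Import boolp classical_sets functions cardinality.

Set Implicit Arguments.
Unset Strict Implicit.
Unset Printing Implicit Defensive.

Import GRing.Theory.
Local Open Scope classical_set_scope.
Local Open Scope card_scope.
Local Open Scope ring_scope.

(* Cardinal numbers are represented by types, considered up to equipotence.
   A cardinal-valued invariant is a relation "[kappa] is (a representative of)
   the invariant", invariant under equipotence of [kappa]. *)

Definition is_card_sup (F : Type -> Prop) (kappa : Type) : Prop :=
  (forall alpha : Type, F alpha -> [set: alpha] #<= [set: kappa]) /\
  (forall beta : Type,
     (forall alpha : Type, F alpha -> [set: alpha] #<= [set: beta]) ->
     [set: kappa] #<= [set: beta]).

Definition is_maximal_in {T : Type} (F : set (set T)) (A : set T) : Prop :=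
  F A /\ forall B : set T, F B -> A `<=` B -> B = A.

Record geometry := Geometry {
  gpoint : Type;
  gline : set (set gpoint);
  point_nonempty : [set: gpoint] !=set0;
  line_two_points : forall l : set gpoint, gline l ->
    exists x y : gpoint, [/\ l x, l y & x <> y]
}.

Definition thick_lines (G : geometry) : Prop :=
  forall l : set (gpoint G), gline l ->
    exists x y z : gpoint G,
      [/\ l x, l y & l z] /\ [/\ x <> y, x <> z & y <> z].

Definition gsubspace (G : geometry) (S : set (gpoint G)) : Prop :=
  forall l : set (gpoint G), gline l ->
    (exists x y : gpoint G, [/\ l x, l y, S x, S y & x <> y]) -> l `<=` S.

Definition generated (G : geometry) (X : set (gpoint G)) : set (gpoint G) :=
  smallest (@gsubspace G) X.

(* For a subspace [S], the closure in the geometry induced on [S] of a subset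
   of [S] is its closure in [G], and [generated X = S] forces [X `<=` S]: this
   is the generating rank of the geometry induced on [S]. *)
Definition is_rank (G : geometry) (S : set (gpoint G)) (kappa : Type) : Prop :=
  (exists X : set (gpoint G), generated X = S /\ [set: kappa] #= X) /\
  (forall X : set (gpoint G), generated X = S -> [set: kappa] #<= X).

Definition is_generating_rank (G : geometry) (kappa : Type) : Prop :=
  is_rank [set: gpoint G] kappa.

Definition collinear (G : geometry) (x y : gpoint G) : Prop :=
  x = y \/ exists l : set (gpoint G), [/\ gline l, l x & l y].

Definition polar_space (G : geometry) : Prop :=
  forall (p : gpoint G) (l : set (gpoint G)), gline l ->
    (exists! x : gpoint G, l x /\ collinear p x) \/
    (forall x : gpoint G, l x -> collinear p x).

Definition nondegenerate_geometry (G : geometry) : Prop :=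
  ~ exists p : gpoint G, forall q : gpoint G, collinear p q.

Definition singular_subspace (G : geometry) (S : set (gpoint G)) : Prop :=
  gsubspace S /\ forall x y : gpoint G, S x -> S y -> collinear x y.

Definition maximal_singular (G : geometry) : set (set (gpoint G)) :=
  is_maximal_in (@singular_subspace G).

Definition is_polar_rank (G : geometry) (kappa : Type) : Prop :=
  is_card_sup
    (fun alpha => exists S : set (gpoint G),
       singular_subspace S /\ is_rank S alpha)
    kappa.

Definition is_polar_corank (G : geometry) (kappa : Type) : Prop :=
  exists n : nat, is_polar_rank G 'I_n /\
    is_generating_rank G (kappa + 'I_(2 * n))%type.

Definition nice (G : geometry) (S : set (gpoint G)) : Prop :=
  gsubspace S /\ exists M N : set (gpoint G),
    [/\ maximal_singular M, maximal_singular N,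
        M `&` N = set0, M `<=` S & N `<=` S].

(* Vector spaces over division rings are left ones; right vector spaces are left
   vector spaces over the opposite ring. *)
Definition division_ring (K : unitRingType) : Prop :=
  forall a : K, a != 0 -> a \is a GRing.unit.

Definition linear_subspace (K : unitRingType) (V : lmodType K) (U : set V) :
  Prop :=
  U 0 /\ forall (a : K) (u v : V), U u -> U v -> U (a *: u + v).

Definition linear_span (K : unitRingType) (V : lmodType K) (A : set V) :
  set V := smallest (@linear_subspace K V) A.

Definition pg_point (K : unitRingType) (V : lmodType K) : set (set V) :=
  [set U | exists v : V, v != 0 /\ U = linear_span [set v]].

(* A line is identified with the set of points it contains. *)
Definition pg_line (K : unitRingType) (V : lmodType K) : set (set (set V)) :=
  [set L | exists A B : set V, [/\ pg_point A, pg_point B, A <> B &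
    L = [set C | pg_point C /\ C `<=` linear_span (A `|` B)]]].

Definition pg_span (K : unitRingType) (V : lmodType K) (Q : set (set V)) :
  set (set V) :=
  [set C | pg_point C /\ C `<=` linear_span (\bigcup_(A in Q) A)].

Definition embedding (G : geometry) (K : unitRingType) (V : lmodType K)
    (e : gpoint G -> set V) : Prop :=
  [/\ forall p : gpoint G, pg_point (e p),
      injective e,
      forall l : set (gpoint G), gline l -> pg_line (e @` l) &
      pg_span (range e) = @pg_point K V].

Definition faithful_embedding (G : geometry) (K : unitRingType)
    (V : lmodType K) (e : gpoint G -> set V) : Prop :=
  embedding e /\
  forall S : set (gpoint G), nice S -> S = e @^-1` (pg_span (e @` S)).

Definition admits_faithful_embedding (G : geometry) : Prop :=
  exists (K : unitRingType) (V : lmodType K) (e : gpoint G -> set V),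
    division_ring K /\ faithful_embedding e.

Definition nice_chain (G : geometry) (C : set (set (gpoint G))) : Prop :=
  [/\ C !=set0, C `<=` @nice G & total_on C subset].

(* [kappa] is |C| - 1, which is |C| when C is infinite. *)
Definition is_chain_length (G : geometry) (C : set (set (gpoint G)))
    (kappa : Type) : Prop :=
  (finite_set C /\ [set: option kappa] #= C) \/
  (infinite_set C /\ [set: kappa] #= C).

Definition nice_WO_chain (G : geometry) (C : set (set (gpoint G))) : Prop :=
  nice_chain C /\
  forall D : set (set (gpoint G)), D `<=` C -> D !=set0 ->
    exists2 M, D M & forall S : set (gpoint G), D S -> M `<=` S.

Definition is_corank_WO (G : geometry) (kappa : Type) : Prop :=
  is_card_sup
    (fun alpha => exists C : set (set (gpoint G)),
       nice_WO_chain C /\ is_chain_length C alpha)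
    kappa.

Definition maximal_nice_WO_chain (G : geometry) : set (set (set (gpoint G))) :=
  is_maximal_in (@nice_WO_chain G).

(* Main.v *)
Require Import Defs.
From mathcomp Require Import all_boot ssralg.
From mathcomp Require Import boolp classical_sets functions cardinality.
From mathcomp Require Import wochoice.

(** Pull the linear closure of the ambient projective space back along the
    embedding: it is a closure operator with exchange on the points, for which
    lines and singular subspaces are closed, disjoint maximal singular subspaces
    are independent, and, by faithfulness, nice subspaces are closed. Hence over
    a pair of disjoint maximal singular subspaces generation and linear span
    coincide, the minimal nice subspaces are those generated by such a pair, all
    of rank twice the polar rank, and the polar corank is the size of a basis
    modulo one of them. A well-ordered nice chain is refined to a maximal one by
    well-ordering the points compatibly with the chain and taking the closures
    of the initial segments. In a maximal chain, picking one point in the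
    successor of every member other than the top gives a basis modulo the
    minimal member, so that all these chains have the same length. *)

Set Implicit Arguments.
Unset Strict Implicit.
Unset Printing Implicit Defensive.

Import GRing.Theory.
Local Open Scope classical_set_scope.
Local Open Scope card_scope.

(** * Cardinals *)

Section Cardinality.
Variables T U : Type.
Implicit Types (A X : set T) (B Y : set U).

Lemma card_le_inj A B (f : T -> U) :
  (forall a, A a -> B (f a)) ->
  (forall a b, A a -> A b -> f a = f b -> a = b) -> A #<= B.
Proof.
move=> fAB fI; have /injfunPex[g] : exists2 f : T -> U, set_fun A B f & set_inj A f.
  exists f => // a b /set_mem Aa /set_mem Ab; exact: fI.
exact: inj_card_le g.
Qed.

(** The comparison as a function on all of [T]; outside [A] it takes the default value [u0]. *)
Lemma card_le_fun (u0 : U) A B : A #<= B -> exists f : T -> U,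
  (forall a, A a -> B (f a)) /\
  (forall a b, A a -> A b -> f a = f b -> a = b).
Proof.
move=> /card_leP[f].
pose g (a : T) : U := if pselect (A a) is left Aa
  then set_val (f (SigSub (mem_set Aa) : set_type A)) else u0.
exists g; split=> [a Aa|a b Aa Ab].
  by rewrite /g; case: pselect => // {}Aa; apply: set_mem; exact: valP.
rewrite /g; case: pselect => // {}Aa; case: pselect => // {}Ab /val_inj fab.
have := @inj _ _ _ f _ _ (mem_set I) (mem_set I) fab.
by move=> /(congr1 set_val).
Qed.

Lemma card_leU1 A B x y : ~ B y -> A #<= B -> A `|` [set x] #<= B `|` [set y].
Proof.
move=> By /(card_le_fun y)[f [fAB fI]].
pose g a := if pselect (A a) then f a else y.
apply: (@card_le_inj _ _ g) => [a|a b]; rewrite /g.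
  by case: pselect => [Aa _|nAa _]; [left; exact: fAB|right].
case: pselect => Aa; case: pselect => Ab /=.
- by move=> _ _; exact: fI.
- by move=> _ _ fa; case: By; rewrite -fa; exact: fAB.
- by move=> _ _ fa; case: By; rewrite fa; exact: fAB.
- by move=> [//|->] [//|->].
Qed.

(** If an injection [f] sends a point of [A] to [y], that point is rerouted to [f x], which lies in
    [B] because injectivity makes it differ from [y]. *)
Lemma card_leU1_inv A B x y : ~ A x ->
  A `|` [set x] #<= B `|` [set y] -> A #<= B.
Proof.
move=> Ax /(card_le_fun y)[f [fAB fI]].
have fx : (B `|` [set y]) (f x) by apply: fAB; right.
have nx a : A a -> f a = f x -> False.
  by move=> Aa /fI afx; apply: Ax; rewrite -afx//; [left|right].
pose g a := if pselect (f a = y) then f x else f a.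
apply: (@card_le_inj _ _ g) => [a Aa|a b Aa Ab]; rewrite /g.
  case: pselect => fa; last by case: (fAB a) => //; left.
  by case: fx => // fx; case: (nx a) => //; rewrite fa.
case: pselect => fa; case: pselect => fb /=.
- by move=> _; apply: fI; [left|left|rewrite fa].
- by move=> fxb; case: (nx b).
- by move=> fxb; case: (nx a).
- by apply: fI; left.
Qed.

End Cardinality.

Lemma card_eqU1 T U (A : set T) (B : set U) x y : ~ A x -> ~ B y ->
  A #= B -> A `|` [set x] #= B `|` [set y].
Proof.
move=> Ax By; rewrite !card_eq_le => /andP[AB BA].
by rewrite !card_leU1.
Qed.

Lemma card_setU1_II T (A : set T) x n : ~ A x -> A #= `I_n ->
  A `|` [set x] #= `I_n.+1.
Proof.
move=> Ax An; apply/eq_cardSP; exists x; first by right.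
suff -> : (A `|` [set x]) `\ x = A by [].
apply/seteqP; split=> [y [[]]//|y Ay]; split; first by left.
by move=> yx; apply: Ax; rewrite -yx.
Qed.

Lemma card_setU_II T (A B : set T) m n : A `&` B = set0 ->
  A #= `I_m -> B #= `I_n -> A `|` B #= `I_(m + n).
Proof.
move=> + + Bn; elim: m A => [|m IHm] A AB Am.
  by move: Am; rewrite II0 card_eq0 => /eqP->; rewrite set0U add0n.
have /eq_cardSP[x Ax Axm] := Am; rewrite addSn.
have AxB : (A `\ x) `&` B = set0.
  by rewrite -subset0 -AB => y [[Ay _] By].
have Bx : ~ B x by move=> Bx; have : (A `&` B) x by []; rewrite AB.
suff -> : A `|` B = ((A `\ x) `|` B) `|` [set x].
  by apply: card_setU1_II; [case=> [[_ []]|]|exact: IHm].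
apply/seteqP; split=> y.
  case=> [Ay|By]; last by left; right.
  by have [yx|yx] := pselect (y = x); [right|left; left].
by case=> [[[Ay _]|By]|->]; [left|right|left].
Qed.

(** One element is cancelled from each of [X] and [Y] at a time, by [card_leU1_inv]. *)
Lemma card_leU_inv T U (A X : set T) (B Y : set U) n :
  X #= `I_n -> Y #= `I_n -> X `&` A = set0 ->
  X `|` A #<= Y `|` B -> A #<= B.
Proof.
elim: n X Y => [|n IHn] X Y; rewrite ?II0.
  by rewrite !card_eq0 => /eqP-> /eqP-> _; rewrite !set0U.
move=> /eq_cardSP[x Xx Xn] /eq_cardSP[y Yy Yn] XA XYAB.
apply: (IHn (X `\ x) (Y `\ y)) => //.
  by rewrite -subset0 -XA => z [[]].
apply: (@card_leU1_inv _ _ _ _ x y).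
  case=> [[_ []]//|Ax]; suff : (X `&` A) x by rewrite XA.
  by [].
have D1 V (Z C : set V) z : Z z -> Z `\ z `|` C `|` [set z] = Z `|` C.
  move=> Zz; apply/seteqP; split=> w; first by case=> [[[]|]|->]; [left|right|left].
  case=> [Zw|Cw]; last by left; right.
  by have [wz|wz] := pselect (w = z); [right|left; left].
by rewrite !D1.
Qed.

Lemma finite_sub_eq T (A B : set T) : finite_set B -> A `<=` B -> B #<= A -> A = B.
Proof.
move=> finB AB BA; apply/seteqP; split=> // x Bx; apply: contrapT => Ax.
have [m Bm] : finite_set (B `\ x) by apply: sub_finite_set finB => y [].
have : A #<= B `\ x.
  by apply: subset_card_le => y Ay; split; [exact: AB|move=> yx; apply: Ax; rewrite -yx].
have Bm1 : B #= `I_m.+1 by apply/eq_cardSP; exists x.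
move=> /(card_le_trans BA).
by rewrite (card_le_eql Bm1) (card_le_eqr Bm) card_le_II ltnn.
Qed.

(** Hilbert's hotel: [h] sends [x] to the start of a sequence [g] in the rest of [A], shifts that
    sequence by one and fixes every other point. *)
Lemma card_infinite_setD1 T (A : set T) x : infinite_set A -> A #<= A `\ x.
Proof.
move=> infA; have infAx : infinite_set (A `\ x).
  move=> finAx; apply: infA; apply: (@sub_finite_set _ _ (A `\ x `|` [set x])).
    by move=> y Ay; have [yx|yx] := pselect (y = x); [right|left].
  by rewrite finite_setU; split.
have [g [gA gI]] := card_le_fun x ((infiniteP _).1 infAx).
pose h a := if pselect (exists k, a = g k) is left e then g (projT1 (cid e)).+1
            else if pselect (a = x) then g 0%N else a.
have hg k : h (g k) = g k.+1.
  rewrite /h; case: pselect => [e|[]]; last by exists k.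
  by case: (cid e) => j /= /gI ->.
have hx : h x = g 0%N.
  rewrite /h; case: pselect => [[k xk]|_]; last by case: pselect.
  by have [_ /(_ (esym xk))] := gA k I.
have hN a : ~ (exists k, a = g k) -> a <> x -> h a = a.
  by move=> ga ax; rewrite /h; case: pselect => // _; case: pselect.
have cases a : (exists k, a = g k) \/ a = x \/ (~ (exists k, a = g k) /\ a <> x).
  have [|ga] := pselect (exists k, a = g k); first by left.
  by have [|ax] := pselect (a = x); right; [left|right].
apply: (@card_le_inj _ _ _ _ h) => [a Aa|a b Aa Ab].
  case: (cases a) => [[k ->]|[->|[ga ax]]].
  - by rewrite hg; exact: gA.
  - by rewrite hx; exact: gA.
  - by rewrite hN.
case: (cases a) => [[k ->]|[->|[ga ax]]];
  case: (cases b) => [[l ->]|[->|[gb bx]]]; rewrite ?hg ?hx ?(hN _ ga) ?(hN _ gb)//.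
- by move=> /gI-/(_ I I)[->].
- by move=> /gI-/(_ I I).
- by move=> gb'; case: gb; exists k.+1.
- by move=> /gI-/(_ I I).
- by move=> gb'; case: gb; exists 0%N.
- by move=> ga'; case: ga; exists l.+1.
- by move=> ga'; case: ga; exists 0%N.
Qed.

Lemma card_II_image T (X : set T) n : X #= `I_n ->
  exists2 g : 'I_n -> T, injective g & range g = X.
Proof.
(* For [n = 0] the type [T] may be empty, and [card_le_fun] has no default value to use. *)
case: n => [|n] Xn.
  move: Xn; rewrite II0 card_eq0 => /eqP->.
  have g : 'I_0 -> T by case.
  exists g => [a|]; first by have := ltn_ord a; rewrite ltn0.
  by rewrite -subset0 => y [a]; have := ltn_ord a; rewrite ltn0.
have /eq_cardSP[x0 _ _] := Xn.
have In : [set: 'I_n.+1] #= X by rewrite -(card_eql card_II) card_eq_sym.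
have := In; rewrite card_eq_le => /andP[/(card_le_fun x0)[g [gX gI]] _].
have {}gI : injective g by move=> a b; exact: gI.
exists g => //; apply: finite_sub_eq; first by exists n.+1.
  by move=> _ [a _ <-]; exact: gX.
have gT : range g #= [set: 'I_n.+1] by apply: inj_card_eq => a b _ _; exact: gI.
by rewrite (card_le_eqr gT) -(card_le_eql In).
Qed.

Lemma card_sum_setU T (A X : set T) n : X `&` A = set0 -> X #= `I_n ->
  [set: A + 'I_n] #= X `|` A.
Proof.
move=> XA /card_II_image[g gI gX].
have gA i (a : A) : g i <> set_val a.
  move=> gia; suff : (X `&` A) (g i) by rewrite XA.
  by split; [rewrite -gX; exists i|rewrite gia; apply: set_mem; exact: valP].
pose f (z : A + 'I_n) := match z with inl a => set_val a | inr i => g i end.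
have fI : injective f.
  case=> [a|i] [b|j] /=.
  - by move=> /val_inj ->.
  - by move=> ab; case: (gA j a).
  - by move=> ab; case: (gA i b).
  - by move=> /gI ->.
suff <- : range f = X `|` A.
  by rewrite card_eq_sym; apply: inj_card_eq => a b _ _; exact: fI.
apply/seteqP; split=> [_ [[a|i] _ <-]|y [|Ay]] /=.
- by right; apply: set_mem; exact: valP.
- by left; rewrite -gX; exists i.
- by rewrite -gX => -[i _ <-]; exists (inr i).
- by exists (inl (SigSub (mem_set Ay) : A)).
Qed.

Lemma card_option_setD1 T U (A : set U) (B : set T) x : B x -> A #= B `\ x ->
  [set: option A] #= B.
Proof.
move=> Bx AB.
have -> : [set: option A] = some @` [set: A] `|` [set None].
  by apply/seteqP; split=> // -[a|] _; [left; exists a|right].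
have -> : B = B `\ x `|` [set x].
  apply/seteqP; split=> y; last by case=> [[]|->].
  by move=> By; have [yx|yx] := pselect (y = x); [right|left].
apply: card_eqU1; [by case|by case=> _ []|].
by rewrite (card_eql card_some) (card_eql (card_setT A)).
Qed.

Lemma card_le_option S T : [set: option S] #<= [set: option T] ->
  [set: S] #<= [set: T].
Proof.
have optE R : [set: option R] = some @` [set: R] `|` [set None].
  by apply/seteqP; split=> // -[a|] _; [left; exists a|right].
rewrite !optE => le_opt; rewrite -card_le_some2.
by apply: card_leU1_inv le_opt; case.
Qed.

(** * Closure operators with exchange *)

(* Finitarity is stated through unions of chains, which is the form used by
   Zorn's lemma and by transfinite arguments. *)
Record pregeometry (T : Type) (cl : set T -> set T) : Prop := Pregeometry {
  cl_ext : forall X, X `<=` cl X;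
  cl_mono : forall X Y, X `<=` Y -> cl X `<=` cl Y;
  cl_idem : forall X, cl (cl X) `<=` cl X;
  cl_exchange : forall X x y, cl (X `|` [set y]) x -> ~ cl X x ->
    cl (X `|` [set x]) y;
  cl_chain : forall F : set (set T), F !=set0 -> total_on F subset ->
    cl (\bigcup_(X in F) X) `<=` \bigcup_(X in F) cl X
}.

Section Pregeometry.
Variables (T : Type) (cl : set T -> set T).
Hypothesis clP : pregeometry cl.
Implicit Types (A B S X : set T).

Definition independent A := forall a, A a -> ~ cl (A `\ a) a.

Definition basis A S := [/\ A `<=` S, independent A & S `<=` cl A].

Definition has_rank S n := exists2 A, basis A S & A #= `I_n.

Lemma cl_sub X Y : X `<=` cl Y -> cl X `<=` cl Y.
Proof. by move=> /(cl_mono clP)/subset_trans; apply; exact: cl_idem. Qed.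

Lemma independent_sub A B : A `<=` B -> independent B -> independent A.
Proof.
move=> AB iB a Aa /(cl_mono clP) h; apply: (iB a (AB a Aa)).
by apply: h => y [Ay ya]; split=> //; exact: AB.
Qed.

(** If some [a] in [A] became dependent once [x] is added, exchanging [a] and [x] would put [x] in
    the closure of [A]. *)
Lemma independentU1 A x : independent A -> ~ cl A x -> independent (A `|` [set x]).
Proof.
move=> iA Ax a; have [->|ax] := pselect (a = x).
  move=> _ /(cl_mono clP) h; apply/Ax/h => y [[//|->]] [].
  by [].
case=> // Aa clAa; apply: Ax.
have clAax : cl (A `\ a `|` [set x]) a.
  move: clAa; apply: (cl_mono clP) => y [[Ay|->] ya]; [by left|by right].
have := cl_exchange clP clAax (iA a Aa); apply: (cl_mono clP).
by move=> y [[]//|->].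
Qed.

(** By [cl_chain], a dependence of [a] already occurs within [A] and one member of the chain, which
    can be taken large enough to account for [a] itself. *)
Lemma independent_bigcup A (F : set (set T)) : independent A ->
  total_on F subset -> (forall X, F X -> independent (A `|` X)) ->
  independent (A `|` \bigcup_(X in F) X).
Proof.
move=> iA totF iF; have [F0|/set0P[X0 FX0]] := eqVneq F set0.
  by rewrite F0 bigcup_set0 setU0.
move=> a Ja; have [X1 FX1 JX1a] : exists2 X, F X & (A `|` X) a.
  by case: Ja => [Aa|[X FX Xa]]; [exists X0 => //; left|exists X => //; right].
pose F' := [set (A `|` X) `\ a | X in F].
have F'sub : (A `|` \bigcup_(X in F) X) `\ a `<=` \bigcup_(Y in F') Y.
  move=> y [[Ay|[X FX Xy]] ya].
    by exists ((A `|` X0) `\ a); [exists X0|split=> //; left].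
  by exists ((A `|` X) `\ a); [exists X|split=> //; right].
have incl X Y : X `<=` Y -> (A `|` X) `\ a `<=` (A `|` Y) `\ a.
  by move=> XY y [[Ay|/XY Yy] ya]; split=> //; [left|right].
have F'tot : total_on F' subset.
  move=> _ _ [X FX <-] [Y FY <-].
  by case: (totF X Y FX FY) => XY; [left|right]; exact: incl.
move=> /(cl_mono clP F'sub)/(cl_chain clP _ F'tot)[]; first by
  exists ((A `|` X0) `\ a), X0.
move=> _ [X2 FX2 <-] cla.
case: (totF X1 X2 FX1 FX2) => X12.
  by apply: (iF X2 FX2 a) cla; case: JX1a => [|/X12]; [left|right].
by apply: (iF X1 FX1 a JX1a); exact: (cl_mono clP (incl _ _ X12)).
Qed.

Lemma basis_extension A S : independent A -> A `<=` S ->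
  exists2 B, basis B S & A `<=` B.
Proof.
move=> iA AS.
(* Zorn's lemma ranges over the sets [B] added to [A], because the union of the empty chain is empty
   and need not contain [A]. *)
have [F FP totF|B [[BS iB] maxB]] :=
    @Zorn_bigcup T [set B | B `<=` S /\ independent (A `|` B)].
  split; first by apply: bigcup_sub => X /FP[].
  by apply: independent_bigcup => // X /FP[].
exists (A `|` B); last by move=> y; left.
split=> //; first by move=> y [/AS|/BS].
move=> s Ss; apply: contrapT => ABs.
apply: (maxB (B `|` [set s])).
  split=> [y|sB]; first by left.
  by apply/ABs/(cl_ext clP); right; apply: sB; right.
split=> [y [/BS|->]//|]; rewrite setUA; exact: independentU1.
Qed.

Lemma ex_basis S : exists A, basis A S.
Proof.
have [|//|A ? _] := @basis_extension set0 S; first by move=> ? [].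
by exists A.
Qed.

(* The graphs [G] ordered by inclusion encode partial injections from [I] to
   [S] along which elements of [I] have been exchanged for elements of [S]. *)
Lemma independent_card_le I S : independent I -> I `<=` cl S -> I #<= S.
Proof.
move=> iI IS.
pose dom (G : set (T * T)) := [set x | exists y, G (x, y)].
pose ran (G : set (T * T)) := [set y | exists x, G (x, y)].
pose exch (G : set (T * T)) := [/\ forall x y, G (x, y) -> I x /\ S y,
  forall x x' y, G (x, y) -> G (x', y) -> x = x',
  (* This keeps the values of [G] apart from the elements of [I] not yet exchanged. *)
  forall y, ran G y -> I y -> dom G y &
  independent (I `\` dom G `|` ran G)].
have [F FP totF|G [[GIS Ginj Gdisj iG] maxG]] := @Zorn_bigcup _ exch.
  split.
  - by move=> x y [G /FP[GIS _ _ _]]; exact: GIS.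
  - move=> x x' y [G FG Gxy] [G' FG' Gxy'].
    have [_ /(_ x x' y) inj _ _] := FP _ FG.
    have [_ /(_ x x' y) inj' _ _] := FP _ FG'.
    by case: (totF G G' FG FG') => sub; [apply: inj'|apply: inj] => //; exact: sub.
  - move=> y [x [G FG Gxy]] Iy; have [_ _ disj _] := FP _ FG.
    by have [|z Gyz] := disj y _ Iy; [exists x|exists z, G].
  - set H := \bigcup_(X in F) X.
    have -> : ran H = \bigcup_(X in ran @` F) X.
      apply/seteqP; split=> [y [x [G FG Gxy]]|y [_ [G FG <-] [x Gxy]]].
        by exists (ran G); [exists G|exists x].
      by exists x, G.
    apply: independent_bigcup.
    + by apply: (independent_sub _ iI) => y [].
    + move=> _ _ [X FX <-] [Y FY <-].
      by case: (totF X Y FX FY) => XY; [left|right] => y [x ?]; exists x; exact: XY.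
    + move=> _ [G FG <-]; have [_ _ _ iGG] := FP _ FG.
      apply: (independent_sub _ iGG) => y [[Iy nHy]|]; [left|by right].
      split=> // -[z Gyz]; apply: nHy.
      by exists z, G.
have domG : I `<=` dom G.
  move=> a Ia; apply: contrapT => nGa.
  have nra : ~ ran G a by move=> /Gdisj/(_ Ia).
  pose J := (I `\` dom G `|` ran G) `\ a.
  have iJ : independent J by apply: (independent_sub _ iG) => y [].
  have Ja : ~ cl J a by apply: iG; left.
  (* If all of [S] lay in [cl J], so would [I], and with it [a]; hence some [s] in [S] can replace
     [a]. *)
  have [s Ss Js] : exists2 s, S s & ~ cl J s.
    apply: contrapT => noS; apply: Ja.
    have : cl S `<=` cl J; last by apply; exact: IS.
    by apply: cl_sub => s Ss; apply: contrapT => Js; apply: noS; exists s.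
  have JNs y : J y -> y <> s by move=> Jy ys; apply/Js/(cl_ext clP); rewrite -ys.
  have Jran y : ran G y -> J y.
    by move=> ry; split; [right|move=> ya; apply: nra; rewrite -ya].
  have rs : ~ ran G s by move=> /Jran/JNs.
  apply: (maxG (G `|` [set (a, s)])).
    split; first by move=> y; left.
    by move=> sub; apply: nGa; exists s; apply: sub; right.
  have domE x : dom (G `|` [set (a, s)]) x <-> dom G x \/ x = a.
    split=> [[y [Gxy|[-> _]]]|[[y Gxy]|->]]; first by left; exists y.
    - by right.
    - by exists y; left.
    - by exists s; right.
  have ranE y : ran (G `|` [set (a, s)]) y <-> ran G y \/ y = s.
    split=> [[x [Gxy|[_ ->]]]|[[x Gxy]|->]]; first by left; exists x.
    - by right.
    - by exists x; left.
    - by exists a; right.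
  split.
  - by move=> x y [/GIS//|[-> ->]].
  - move=> x x' y [Gxy|[xa ys]] [Gxy'|[x'a ys']].
    + exact: Ginj Gxy Gxy'.
    + by case: rs; exists x; rewrite -ys'.
    + by case: rs; exists x'; rewrite -ys.
    + by rewrite xa.
  - move=> y /ranE[ry|->] Iy; apply/domE; first by left; exact: Gdisj.
    have [|nGs] := pselect (dom G s); first by left.
    by have [|sa] := pselect (s = a); [right|case: (JNs s); first by split=> //; left].
  - apply: (independent_sub _ (independentU1 iJ Js)) => y [[Iy nGy]|].
      by left; split; [left; split=> // Gy; apply/nGy/domE; left
                      |move=> ya; apply/nGy/domE; right].
    by move=> /ranE[/Jran|->]; [left|right].
have /choice[f fP] x : exists y, I x -> G (x, y).
  have [/domG[y Gxy]|nIx] := pselect (I x); first by exists y.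
  by exists x.
apply: (@card_le_inj _ _ _ _ f) => [a /fP/GIS[]//|a b /fP Ga /fP Gb ab].
by apply: Ginj Ga _; rewrite ab.
Qed.

Lemma basis_card_eq A B S : basis A S -> basis B S -> A #= B.
Proof.
move=> [AS iA SA] [BS iB SB]; rewrite card_eq_le.
rewrite (independent_card_le iA (subset_trans AS SB)).
by rewrite (independent_card_le iB (subset_trans BS SA)).
Qed.

Lemma has_rank_uniq S m n : has_rank S m -> has_rank S n -> m = n.
Proof.
move=> [A bA Am] [B bB Bn]; apply/card_eq_II.
by rewrite -(card_eql Am) -(card_eqr Bn); exact: basis_card_eq bA bB.
Qed.

Lemma basisU1 A H S p : basis A H -> ~ cl H p -> S p -> H `<=` S ->
  S `<=` cl (H `|` [set p]) -> basis (A `|` [set p]) S.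
Proof.
move=> [AH iA HA] Hp Sp HS SHp; split.
- by move=> y [/AH/HS|->].
- by apply: independentU1 => // /(cl_mono clP AH).
- apply: (subset_trans SHp); apply: cl_sub => y [/HA|->].
    by apply: (cl_mono clP) => z; left.
  by apply: (cl_ext clP); right.
Qed.

Lemma has_rankU1 H S p n : has_rank H n -> ~ cl H p -> S p -> H `<=` S ->
  S `<=` cl (H `|` [set p]) -> has_rank S n.+1.
Proof.
move=> [A bA An] Hp Sp HS SHp; exists (A `|` [set p]); first exact: basisU1 bA _ _ _ _.
apply: card_setU1_II => // Ap; apply/Hp/(cl_ext clP).
by case: bA => AH _ _; exact: AH.
Qed.

Lemma has_rank_le S S' m n : has_rank S m -> has_rank S' n -> S `<=` cl S' ->
  (m <= n)%N.
Proof.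
move=> [A [AS iA SA] Am] [B [BS iB SB] Bn] SS'.
rewrite -card_le_II -(card_le_eql Am) -(card_le_eqr Bn).
apply: independent_card_le => //; apply: (subset_trans AS).
by apply: (subset_trans SS'); exact: cl_sub.
Qed.

(** Equal finite ranks leave no room: a basis of [S], extended to a basis of the closure of a basis
    of [S'], gains no element. *)
Lemma has_rank_cl S S' n : has_rank S n -> has_rank S' n -> S `<=` cl S' ->
  S' `<=` cl S.
Proof.
move=> [A [AS iA SA] An] [B [BS iB SB] Bn] SS'.
have AS' : A `<=` cl B by move=> y /AS/SS'; exact: cl_sub.
have [A' [A'B iA' BA'] AA'] := basis_extension iA AS'.
have A'n : A' #<= A.
  apply: card_le_trans (independent_card_le iA' A'B) _.
  by rewrite (card_le_eql Bn) (card_le_eqr An) card_le_II.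
have -> : cl S = cl A' .
  rewrite -(finite_sub_eq _ AA' A'n); last first.
    by apply: card_le_finite A'n _; exists n.
  apply/seteqP; split; first exact: cl_sub.
  exact: (cl_mono clP).
by apply: (subset_trans SB); apply: cl_sub; apply: subset_trans BA'; exact: cl_ext.
Qed.

End Pregeometry.

(** * The closure induced by a faithful embedding *)

Section LinearSpan.
Variables (K : unitRingType) (V : lmodType K).
Local Open Scope ring_scope.
Implicit Types (A B X Y : set V) (u v w : V) (a b : K).

Lemma linear_subspace_span A : linear_subspace (linear_span A).
Proof.
split=> [W [[W0 _] _]//|a u v Au Av W WA].
by case: (WA) => -[_ Wlin] _; apply: Wlin; [exact: Au|exact: Av].
Qed.

Lemma linear_span0 A : linear_span A 0.
Proof. by case: (linear_subspace_span A). Qed.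

Lemma linear_spanD A u v : linear_span A u -> linear_span A v ->
  linear_span A (u + v).
Proof.
by case: (linear_subspace_span A) => _ + Au Av; move/(_ 1 u v Au Av); rewrite scale1r.
Qed.

Lemma linear_spanZ A a u : linear_span A u -> linear_span A (a *: u).
Proof.
case: (linear_subspace_span A) => A0 + Au; move/(_ a u 0 Au A0).
by rewrite addr0.
Qed.

Lemma linear_spanN A u : linear_span A u -> linear_span A (- u).
Proof. by rewrite -scaleN1r; exact: linear_spanZ. Qed.

Lemma sub_linear_span A : A `<=` linear_span A.
Proof. exact: sub_gen_smallest. Qed.

Lemma linear_span_sub A B : A `<=` linear_span B -> linear_span A `<=` linear_span B.
Proof. by apply: smallest_sub; exact: linear_subspace_span. Qed.

Lemma linear_span_mono A B : A `<=` B -> linear_span A `<=` linear_span B.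
Proof. by move=> AB; apply: linear_span_sub => u /AB; exact: sub_linear_span. Qed.

Lemma linear_span1P v u : linear_span [set v] u -> exists a, u = a *: v.
Proof.
have : linear_span [set v] `<=` [set u | exists a, u = a *: v]; last by apply.
apply: smallest_sub => [|_ ->]; last by exists 1; rewrite scale1r.
split=> [|a _ _ [b ->] [c ->]]; first by exists 0; rewrite scale0r.
by exists (a * b + c); rewrite scalerDl scalerA.
Qed.

Lemma linear_spanUP A B u : linear_span (A `|` B) u ->
  exists x y, [/\ linear_span A x, linear_span B y & u = x + y].
Proof.
have : linear_span (A `|` B) `<=`
    [set u | exists x y, [/\ linear_span A x, linear_span B y & u = x + y]].
  apply: smallest_sub => [|w [Aw|Bw]].
  - split=> [|a _ _ [x [y [Ax By ->]]] [x' [y' [Ax' By' ->]]]].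
      by exists 0, 0; split; rewrite ?addr0//; exact: linear_span0.
    exists (a *: x + x'), (a *: y + y'); split.
    + by apply: linear_spanD => //; exact: linear_spanZ.
    + by apply: linear_spanD => //; exact: linear_spanZ.
    + by rewrite scalerDr addrACA.
  - exists w, 0; rewrite addr0; split=> //; first exact: sub_linear_span.
    exact: linear_span0.
  - exists 0, w; rewrite add0r; split=> //; first exact: linear_span0.
    exact: sub_linear_span.
by apply.
Qed.

(** Exchange divides by the coefficient [a] of [y], invertible in a division ring. The union of a
    chain of linear subspaces is linear because any two of its vectors lie in a common member. *)
Lemma pregeometry_linear_span : division_ring K -> pregeometry (@linear_span K V).
Proof.
move=> divK; split.
- exact: sub_linear_span.
- exact: linear_span_mono.
- by move=> X; exact: linear_span_sub.
- move=> X x y /linear_spanUP[w [_ [Xw /linear_span1P[a ->] ->]]] nX.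
  have [a0|a0] := eqVneq a 0.
    by case: nX; rewrite a0 scale0r addr0.
  have yE : a^-1 *: ((w + a *: y) + - w) = y.
    by rewrite addrAC subrr add0r scalerA mulVr ?scale1r//; exact: divK.
  rewrite -[Z in linear_span _ Z]yE; apply: linear_spanZ; apply: linear_spanD.
    by apply: sub_linear_span; right.
  by apply: linear_spanN; apply: linear_span_mono Xw => z; left.
- move=> F [X0 FX0] totF; apply: smallest_sub => [|u [X FX Xu]]; last first.
    by exists X => //; exact: sub_linear_span.
  split=> [|a u v [X FX Xu] [Y FY Yv]].
    by exists X0 => //; exact: linear_span0.
  have spanZD Z : F Z -> linear_span Z u -> linear_span Z v ->
      (\bigcup_(Z in F) linear_span Z) (a *: u + v).
    by move=> FZ Zu Zv; exists Z => //; apply: linear_spanD Zv; exact: linear_spanZ.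
  case: (totF X Y FX FY) => XY; [apply: (spanZD Y) => //|apply: (spanZD X) => //].
    exact: linear_span_mono Xu.
  exact: linear_span_mono Yv.
Qed.

End LinearSpan.

(** * Closure operators pulled back along a map, and closures of pairs *)

Lemma pregeometry_preimage T U (cl : set U -> set U) (f : T -> U) :
  pregeometry cl -> pregeometry (fun X => f @^-1` cl (f @` X)).
Proof.
move=> clP; split.
- by move=> X x Xx; apply: (cl_ext clP); exists x.
- by move=> X Y XY x; apply: (cl_mono clP); exact: image_subset.
- move=> X x; apply: (cl_sub clP) => _ [y + <-].
  exact.
- move=> X x y; rewrite /preimage /= !image_setU !image_set1.
  exact: (cl_exchange clP).
- move=> F [X0 FX0] totF x /= clFx.
  have F'0 : [set f @` X | X in F] !=set0 by exists (f @` X0), X0.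
  have F'tot : total_on [set f @` X | X in F] subset.
    move=> _ _ [X FX <-] [Y FY <-].
    by case: (totF X Y FX FY) => XY; [left|right]; exact: image_subset.
  have [|_ [X FX <-] clX] := cl_chain clP F'0 F'tot (t := f x); last by exists X.
  apply: (cl_mono clP) clFx => _ [y [X FX Xy] <-].
  by exists (f @` X); [exists X|exists y].
Qed.

(** Meant for lines: a projective line comes with two generators [a] and [b], but has to be spanned
    by any two distinct points on it. *)
Lemma cl_pair T (cl : set T -> set T) (a b x y : T) : pregeometry cl ->
  cl [set a; b] x -> cl [set a; b] y -> ~ cl set0 x -> ~ cl [set x] y ->
  [set a; b] `<=` cl [set x; y].
Proof.
move=> clP abx aby x0 xy.
have exch X u v := @cl_exchange _ _ clP X u v.
have ext X z (Xz : X z) := cl_ext clP Xz.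
have sub2 u v w : cl [set u] v -> cl [set u; w] v.
  by apply: (cl_mono clP) => z; left.
(* It suffices to treat one generator [a] outside the closure of the other. *)
have gen c d : cl [set c; d] x -> cl [set c; d] y -> ~ cl [set d] x ->
    cl [set x; y] c /\ cl [set x; y] d.
  move=> cdx cdy dx.
  have cdx' : cl [set d; x] c by apply: exch => //; rewrite setUC.
  have yxd : cl [set x; d] y.
    apply: (cl_sub clP) cdy => z [->|->]; last by apply: ext; right.
    by rewrite setUC.
  have xyd : cl [set x; y] d by exact: exch.
  split=> //; apply: (cl_sub clP) cdx' => z [->//|->].
  by apply: ext; left.
have [bx|bx] := pselect (cl [set b] x); last first.
  by case: (gen a b) => // xa xb z [->|->].
have xb : cl [set x] b.
  by rewrite -[X in cl X]set0U; apply: exch => //; rewrite set0U.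
have xy' : cl [set x; y] a.
  apply: exch => //; apply: (cl_sub clP) aby => z [->|->].
    by apply: ext; right.
  exact: sub2.
by move=> z [->//|->]; exact: sub2.
Qed.

Section Singular.
Variable G : geometry.
Implicit Types (S X : set (gpoint G)) (p q : gpoint G).

Lemma singular_line S p q : singular_subspace S -> S p -> S q -> p <> q ->
  exists l, [/\ gline l, l p, l q & l `<=` S].
Proof.
move=> [subS colS] Sp Sq pq; case: (colS p q Sp Sq) => // -[l [gl lp lq]].
by exists l; split=> //; apply: subS => //; exists p, q.
Qed.

End Singular.

(* The trace on the points of [G] of the linear closure in an ambient faithful
   embedding. *)
Record polar_closure (G : geometry)
    (cl : set (gpoint G) -> set (gpoint G)) : Prop := PolarClosure {
  pc_pregeometry : pregeometry cl;
  pc_subspace : forall X, gsubspace (cl X);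
  pc_singular : forall S, singular_subspace S -> cl S `<=` S;
  pc_disjoint : forall M N A B, singular_subspace M -> singular_subspace N ->
    M `&` N = set0 -> A `<=` M -> B `<=` N -> N `&` cl (A `|` B) `<=` cl B;
  pc_nice : forall S, nice S -> cl S `<=` S
}.

(** * The trace of the linear closure on the embedded points *)

Section FaithfulEmbedding.
Local Open Scope ring_scope.
Variables (G : geometry) (K : unitRingType) (V : lmodType K).
Variables (e : gpoint G -> set V) (v : gpoint G -> V).
Hypotheses (divK : division_ring K) (embe : embedding e).
Hypotheses (v0 : forall p, v p != 0) (ve : forall p, e p = linear_span [set v p]).
Implicit Types (p q : gpoint G) (S X : set (gpoint G)).

Let lsP := pregeometry_linear_span V divK.

(** One chosen vector [v p] per point turns the trace into a preimage under a map, as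
    [pregeometry_preimage] requires. *)
Definition embedding_closure X := v @^-1` @linear_span K V (v @` X).

Let not_span0 (w : V) : w != 0 -> ~ linear_span set0 w.
Proof.
move=> /eqP w0 /(_ [set 0]) h; apply: w0; apply: h; split=> //.
by split=> // a x y -> ->; rewrite scaler0 addr0.
Qed.

Let span1_eq (w u : V) : w != 0 -> linear_span [set u] w ->
  linear_span [set w] = linear_span [set u].
Proof.
move=> w0 uw; apply/seteqP; split; first by apply: linear_span_sub => _ ->.
apply: linear_span_sub => _ ->; rewrite -[X in linear_span X]set0U.
by apply: (cl_exchange lsP); [rewrite set0U|exact: not_span0].
Qed.

Lemma embedding_point_eq p q : e q (v p) -> p = q.
Proof.
case: embe => _ eI _ _ eqvp; apply: eI; rewrite !ve; apply: span1_eq => //.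
by rewrite -ve.
Qed.

Lemma embedding_line l p q x : gline l -> l p -> l q -> p <> q -> l x ->
  linear_span [set v p; v q] (v x).
Proof.
case: embe => _ _ el _ gl lp lq pq lx.
have [A [B [[a [a0 Aa]] [b [b0 Bb]] AB lE]]] := el l gl.
have ABsub : linear_span (A `|` B) `<=` linear_span [set a; b].
  apply: linear_span_sub => w [|]; rewrite ?Aa ?Bb;
  apply: linear_span_mono => z ->; [by left|by right].
have lab y : l y -> linear_span [set a; b] (v y).
  move=> ly; apply: ABsub; have : (e @` l) (e y) by exists y.
  rewrite lE => -[_]; apply; rewrite ve; exact: sub_linear_span.
suff : [set a; b] `<=` linear_span [set v p; v q].
  by move=> /linear_span_sub; apply; exact: lab.
apply: (cl_pair lsP); [exact: lab|exact: lab|exact: not_span0|].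
by rewrite -ve => /embedding_point_eq qp; apply: pq.
Qed.

Lemma embedding_closure_subspace X : gsubspace (embedding_closure X).
Proof.
move=> l gl [p [q [lp lq Xp Xq pq]]] x lx.
have := embedding_line gl lp lq pq lx; apply: linear_span_sub.
by move=> _ [->|->].
Qed.

Let cone S := [set w | w = 0 \/ exists2 p, S p & e p w].

(** The image of a line inside [S] is a full projective line, so the projective point spanned by a
    nonzero combination of vectors on two of its points is again the image of a point of [S]. *)
Let cone_linear S : singular_subspace S -> linear_subspace (cone S).
Proof.
move=> sS; split=> [|a u w Su Sw]; first by left.
have [z0|z0] := eqVneq (a *: u + w) 0; first by left.
have lin p : linear_subspace (e p) by rewrite ve; exact: linear_subspace_span.
have scale p b z : e p z -> e p (b *: z).
  by rewrite ve; exact: linear_spanZ.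
case: Su => [->|[p Sp pu]]; first by rewrite scaler0 add0r.
case: Sw => [->|[q Sq qw]].
  by right; exists p => //; rewrite addr0; exact: scale.
have [pq|pq] := pselect (p = q).
  by right; exists p => //; case: (lin p) => _; apply=> //; rewrite pq.
have [l [gl lp lq lS]] := singular_line sS Sp Sq pq.
case: embe => _ _ el _; have [A [B [_ _ _ lE]]] := el l gl.
have sub y : l y -> e y `<=` linear_span (A `|` B).
  by move=> ly; have : (e @` l) (e y) by [exists y]; rewrite lE => -[].
have : (e @` l) (linear_span [set a *: u + w]).
  rewrite lE; split; first by exists (a *: u + w).
  apply: linear_span_sub => _ ->; apply: linear_spanD.
    by apply: linear_spanZ; apply: (sub p).
  exact: (sub q).
move=> [r lr er]; right; exists r; first exact: lS.
by rewrite er; exact: sub_linear_span.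
Qed.

Let span_cone S : singular_subspace S -> linear_span (v @` S) `<=` cone S.
Proof.
move=> sS; apply: smallest_sub; first exact: cone_linear.
by move=> _ [p Sp <-]; right; exists p => //; rewrite ve; exact: sub_linear_span.
Qed.

Lemma embedding_closure_singular S : singular_subspace S ->
  embedding_closure S `<=` S.
Proof.
move=> sS p /(span_cone sS)[vp0|[q Sq /embedding_point_eq ->//]].
by case/eqP: (v0 p).
Qed.

(** Write [v p] as [x + y] along [A] and [B]. Then [x] lies in the cone of [M], and as [v p - y]
    also in that of [N]; if nonzero, it would span the image of a common point of [M] and [N]. *)
Lemma embedding_closure_disjoint M N A B : singular_subspace M ->
  singular_subspace N -> M `&` N = set0 -> A `<=` M -> B `<=` N ->
  N `&` embedding_closure (A `|` B) `<=` embedding_closure B.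
Proof.
move=> sM sN MN AM BN p [Np]; rewrite /embedding_closure /= image_setU.
move=> /linear_spanUP[x [y [Ax By xy]]].
have [x0|x0] := eqVneq x 0; first by rewrite xy x0 add0r.
have [xe|[m Mm mx]] : cone M x.
- by apply: (span_cone sM); apply: linear_span_mono Ax; exact: image_subset.
- by rewrite xe eqxx in x0.
have [xe|[n Nn nx]] : cone N x.
- apply: (span_cone sN); have -> : x = v p + - y by rewrite xy addrK.
  apply: linear_spanD; first by apply: sub_linear_span; exists p.
  by apply: linear_spanN; apply: linear_span_mono By; exact: image_subset.
- by rewrite xe eqxx in x0.
suff mn : m = n by have : (M `&` N) m; [by split=> //; rewrite mn|rewrite MN].
case: embe => _ eI _ _; apply: eI; rewrite !ve in mx nx *.
by rewrite -(span1_eq x0 mx) (span1_eq x0 nx).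
Qed.

Lemma embedding_closure_span S p : embedding_closure S p -> pg_span (e @` S) (e p).
Proof.
move=> Sp; split; first by case: embe.
rewrite ve; apply: linear_span_sub => _ ->; apply: linear_span_mono Sp.
move=> _ [q Sq <-]; exists (e q); first by exists q.
by rewrite ve; exact: sub_linear_span.
Qed.

End FaithfulEmbedding.

Lemma faithful_polar_closure (G : geometry) : admits_faithful_embedding G ->
  exists cl : set (gpoint G) -> set (gpoint G), polar_closure cl.
Proof.
move=> [K [V [e [divK [embe faithe]]]]].
have /choice[v vP] p : exists w : V, w != 0%R /\ e p = linear_span [set w].
  by case: embe => /(_ p).
have v0 p : v p != 0%R by case: (vP p).
have ve p : e p = linear_span [set v p] by case: (vP p).
exists (embedding_closure v); split.
- exact: pregeometry_preimage (pregeometry_linear_span V divK).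
- exact: embedding_closure_subspace ve.
- exact: embedding_closure_singular ve.
- exact: embedding_closure_disjoint ve.
(* Faithfulness enters here: it makes nice subspaces closed. *)
- by move=> S /faithe{2}-> p; exact: embedding_closure_span.
Qed.

(** * Singular and nice subspaces of polar spaces *)

Section PolarSpace.
Variable G : geometry.
Hypothesis polG : polar_space G.
Implicit Types (p q x y z : gpoint G) (X S M N : set (gpoint G)).

Lemma collinear_sym x y : collinear x y -> collinear y x.
Proof. by move=> [->|[l [gl lx ly]]]; [left|right; exists l]. Qed.

Lemma gsubspaceI X S : gsubspace X -> gsubspace S -> gsubspace (X `&` S).
Proof.
move=> sX sS l gl [x [y [lx ly [Xx Sx] [Xy Sy] xy]]].
by rewrite subsetI; split; [apply: sX|apply: sS] => //; exists x, y.
Qed.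

Lemma gsubspace_generated X : gsubspace (generated X).
Proof.
move=> l gl [x [y [lx ly Xx Xy xy]]] z lz S [sS XS].
apply: (sS l gl _ z lz); exists x, y; split=> //.
  by apply: Xx.
by apply: Xy.
Qed.

(** This is the one-or-all axiom: two points of a line collinear with [x] exclude the case of
    exactly one. *)
Lemma gsubspace_perp x : gsubspace (collinear x).
Proof.
move=> l gl [y [z [ly lz xy xz yz]]].
have [[w [_ wu]]|//] := polG x gl.
by case: yz; rewrite -(wu y)// -(wu z).
Qed.

(** [gsubspace_perp] is applied twice, first at points of [X] and then at points of the generated
    subspace. *)
Lemma generated_singular X : (forall x y, X x -> X y -> collinear x y) ->
  singular_subspace (generated X).
Proof.
move=> Xcol; split; first exact: gsubspace_generated.
have genX x : X x -> generated X `<=` collinear x.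
  move=> Xx; apply: smallest_sub; first exact: gsubspace_perp.
  by move=> y; exact: Xcol.
move=> x y Xx; have : generated X `<=` collinear x; last by apply.
apply: smallest_sub; first exact: gsubspace_perp.
by move=> z Xz; apply: collinear_sym; exact: genX Xx.
Qed.

Variable cl : set (gpoint G) -> set (gpoint G).
Hypothesis clG : polar_closure cl.

Let clP := pc_pregeometry clG.

Lemma generated_cl X : generated X `<=` cl X.
Proof. by apply: smallest_sub; [exact: pc_subspace|exact: cl_ext]. Qed.

(** The generated subspace is singular, hence already closed. *)
Lemma cl_collinear X : (forall x y, X x -> X y -> collinear x y) ->
  cl X = generated X.
Proof.
move=> Xcol; apply/seteqP; split; last exact: generated_cl.
apply: subset_trans (pc_singular clG (generated_singular Xcol)).
by apply: (cl_mono clP); exact: sub_gen_smallest.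
Qed.

Lemma cl_singular X : (forall x y, X x -> X y -> collinear x y) ->
  singular_subspace (cl X).
Proof. by move=> Xcol; rewrite cl_collinear//; exact: generated_singular. Qed.

Lemma collinearU1 S x : singular_subspace S -> S `<=` collinear x ->
  forall y z, (S `|` [set x]) y -> (S `|` [set x]) z -> collinear y z.
Proof.
move=> [_ colS] xS y z [Sy|->] [Sz|->]; [exact: colS| |exact: xS|by left].
by apply: collinear_sym; exact: xS.
Qed.

Lemma singularI S M : singular_subspace S -> gsubspace M ->
  singular_subspace (S `&` M).
Proof.
move=> [sS colS] sM; split; first exact: gsubspaceI.
by move=> x y [Sx _] [Sy _]; exact: colS.
Qed.

(** A line of [S] through [p] has exactly one point collinear with [x]; it differs from [p], so
    together with [p] it spans the line. *)
Lemma cl_hyperplane S x p : singular_subspace S -> S p -> ~ collinear x p ->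
  S `<=` cl (S `&` collinear x `|` [set p]).
Proof.
move=> sS Sp xp r Sr; have [->|rp] := pselect (r = p).
  by apply: (cl_ext clP); right.
have [l [gl lr lp lS]] := singular_line sS Sr Sp rp.
case: (polG x gl) => [[z [[lz xz] _]]|/(_ p lp)//].
apply: (pc_subspace clG gl _ lr); exists z, p; split=> //.
- by apply: (cl_ext clP); left; split=> //; exact: lS.
- by apply: (cl_ext clP); right.
- by move=> zp; apply: xp; rewrite -zp.
Qed.

(** * Ranks of singular subspaces and pairs of disjoint maximal ones *)

Variable n : nat.
Hypothesis rkG : is_polar_rank G 'I_n.

Local Notation rank := (has_rank cl).

(** Generation and linear closure agree on a singular subspace, so bases of the closure measure its
    generating rank. *)
Lemma basis_is_rank S B : singular_subspace S -> basis cl B S -> is_rank S B.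
Proof.
move=> sS [BS iB SB]; split.
  exists B; split; last exact: card_setT.
  rewrite -cl_collinear; last by move=> x y /BS Sx /BS Sy; case: sS => _; apply.
  apply/seteqP; split=> //; apply: subset_trans (pc_singular clG sS).
  exact: (cl_mono clP).
move=> X XS; rewrite (card_le_eql (card_setT B)).
apply: (independent_card_le clP iB); apply: (subset_trans BS).
by rewrite -XS; exact: generated_cl.
Qed.

Lemma singular_rank S : singular_subspace S -> exists2 k, (k <= n)%N & rank S k.
Proof.
move=> sS; have [B bB] := ex_basis clP S.
have Bn : B #<= [set: 'I_n].
  rewrite -(card_le_eql (card_setT B)); apply: rkG.1.
  by exists S; split=> //; exact: basis_is_rank.
have [k Bk] : finite_set B.
  by apply: card_le_finite Bn _; exact: finite_finset.
exists k; last by exists B.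
by rewrite -card_le_II -(card_le_eql Bk) (card_le_eqr card_II).
Qed.

Lemma ex_singular_rank : exists2 S, singular_subspace S & rank S n.
Proof.
apply: contrapT => noS.
have lt S k : singular_subspace S -> rank S k -> (k < n)%N.
  move=> sS rS; have [j jn rj] := singular_rank sS.
  rewrite (has_rank_uniq clP rS rj) ltn_neqAle jn andbT.
  by apply/eqP => jE; apply: noS; exists S => //; rewrite -jE.
(* The empty subspace has rank below [n], so [n] is positive and [n.-1] is a strictly smaller
   bound. *)
have s0 : @singular_subspace G set0.
  by split=> // l _ [x [y []]].
have [k0 _ /(lt _ _ s0) k0n] := singular_rank s0.
have : [set: 'I_n] #<= [set: 'I_n.-1].
  apply: rkG.2 => alpha [S [sS [[X [XS aX]] minX]]].
  have [k _ rS] := singular_rank sS; have kn := lt _ _ sS rS.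
  have [B bB Bk] := rS; have [[Y [YS BY]] _] := basis_is_rank sS bB.
  apply: card_le_trans (minX _ YS) _.
  rewrite -(card_le_eql BY) (card_le_eql (card_setT B)) (card_le_eql Bk).
  by rewrite -(card_le_eqr card_II) card_le_II -ltnS (ltn_predK k0n).
rewrite -(card_le_eqr card_II) -(card_le_eql card_II) card_le_II.
by rewrite -ltnS (ltn_predK k0n) ltnn.
Qed.

Lemma singular_rank_lt S S' k k' x : singular_subspace S -> S `<=` S' ->
  S' x -> ~ S x -> rank S k -> rank S' k' -> (k < k')%N.
Proof.
move=> sS SS' S'x Sx rS rS'; rewrite ltn_neqAle; apply/andP; split.
  apply/eqP => kk'; rewrite -kk' in rS'; apply/Sx/(pc_singular clG sS).
  apply: (has_rank_cl clP rS rS') => //.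
  by apply: (subset_trans SS'); exact: cl_ext.
by apply: (has_rank_le clP rS rS'); apply: (subset_trans SS'); exact: cl_ext.
Qed.

Lemma rank_maximal_singular N : singular_subspace N -> rank N n ->
  maximal_singular N.
Proof.
move=> sN rN; split=> // S sS NS; apply/seteqP; split=> // x Sx.
apply: contrapT => Nx; have [k kn rS] := singular_rank sS.
by have := singular_rank_lt sN NS Sx Nx rN rS; rewrite ltnNge kn.
Qed.

(* Exchanging [N] for [N'] enlarges the intersection with a maximal singular
   subspace through [q], and shrinks it for one through [p]. *)
Lemma singular_swap N p q : singular_subspace N -> rank N n -> N p ->
  ~ collinear q p ->
  let N' := cl (N `&` collinear q `|` [set q]) in
  [/\ singular_subspace N', rank N' n, N' q & N `&` collinear q `<=` N'].
Proof.
move=> sN rN Np qp N'; pose H := N `&` collinear q.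
have sH : singular_subspace H by apply: singularI => //; exact: gsubspace_perp.
have clH := pc_singular clG sH.
have sN' : singular_subspace N'.
  by apply: cl_singular; apply: collinearU1 => // y [].
have extN' : H `|` [set q] `<=` N' by exact: cl_ext.
have N'q : N' q by apply: extN'; right.
split=> //; last by move=> y Hy; apply: extN'; left.
have [k _ rH] := singular_rank sH.
have Hp : ~ cl H p by move=> /clH[].
have Hq : ~ cl H q by move=> /clH[Nq _]; apply: qp; case: sN => _; apply.
have rN1 : rank N k.+1.
  by apply: (has_rankU1 clP rH Hp) => // [y []//|]; exact: cl_hyperplane.
rewrite (has_rank_uniq clP rN rN1).
by apply: (has_rankU1 clP rH Hq) => // y Hy; apply: extN'; left.
Qed.

(** A singular [N] of rank [n] is swapped until it contains [M], and then equals [M] by maximality;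
    [d] bounds the rank still missing from the intersection. *)
Lemma maximal_singular_rank M : maximal_singular M -> rank M n.
Proof.
move=> [sM maxM]; suff gen d N k : singular_subspace N -> rank N n ->
    rank (M `&` N) k -> (n - k < d)%N -> rank M n.
  have [N sN rN] := ex_singular_rank.
  have [k _ rMN] := singular_rank (singularI sM sN.1).
  exact: gen sN rN rMN (ltnSn _).
elim: d N k => // d IHd N k sN rN rMN; rewrite ltnS => kd.
have [MN|] := pselect (M `<=` N); first by rewrite -(maxM N sN MN).
move=> /existsNP[q /not_implyP[Mq Nq]].
have [p Np qp] : exists2 p, N p & ~ collinear q p.
  apply: contrapT => colN; have qN : N `<=` collinear q.
    by move=> p Np; apply: contrapT => qp; apply: colN; exists p.
  have [_ maxN] := rank_maximal_singular sN rN; apply: Nq.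
  rewrite -(maxN (cl (N `|` [set q]))).
  - by apply: (cl_ext clP); right.
  - by apply: cl_singular; exact: collinearU1.
  - by move=> x Nx; apply: (cl_ext clP); left.
have [sN' rN' N'q N'H] := singular_swap sN rN Np qp.
set N' := cl _ in sN' rN' N'q N'H.
have [k' k'n rMN'] := singular_rank (singularI sM sN'.1).
have kk' : (k < k')%N.
  apply: (@singular_rank_lt (M `&` N) (M `&` N') _ _ q) => //.
  - exact: singularI sM sN.1.
  - move=> x [Mx Nx]; split=> //; apply: N'H; split=> //.
    by case: sM => _; apply.
  - by case.
apply: (IHd N' k') => //; apply: leq_trans kd.
by rewrite ltn_sub2l// (leq_trans kk').
Qed.

(** Starting from [N = M], swaps at points [q] not collinear with a common point [p], which exist by
    non-degeneracy, shrink the intersection until it is empty. *)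
Lemma ex_disjoint_maximal_singular : nondegenerate_geometry G ->
  exists M N, [/\ maximal_singular M, maximal_singular N & M `&` N = set0].
Proof.
move=> ndG; have [M sM rM] := ex_singular_rank.
suff gen d N k : singular_subspace N -> rank N n -> rank (M `&` N) k ->
    (k < d)%N -> exists N', [/\ singular_subspace N', rank N' n & M `&` N' = set0].
  have [k _ rMM] := singular_rank (singularI sM sM.1).
  have [N [sN rN MN]] := gen _ _ _ sM rM rMM (ltnSn _).
  by exists M, N; split=> //; exact: rank_maximal_singular.
elim: d N k => // d IHd N k sN rN rMN; rewrite ltnS => kd.
have [MN0|/set0P[p [Mp Np]]] := eqVneq (M `&` N) set0; first by exists N.
have [q qp] : exists q, ~ collinear q p.
  apply: contrapT => colp; apply: ndG; exists p => q.
  apply: collinear_sym; apply: contrapT => qp; apply: colp.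
  by exists q.
have [sN' rN' N'q N'H] := singular_swap sN rN Np qp.
set N' := cl _ in sN' rN' N'q N'H.
have sH : singular_subspace (N `&` collinear q).
  by apply: singularI => //; exact: gsubspace_perp.
(* A point [r] of [M] and [N'] outside [N] could be exchanged for [q], putting [q] in a subspace
   generated by points collinear with [p]. *)
have MN'N : M `&` N' `<=` M `&` N.
  move=> r [Mr N'r]; split=> //; apply: contrapT => Nr.
  have Hr : ~ cl (N `&` collinear q) r by move=> /(pc_singular clG sH)[].
  have := cl_exchange clP N'r Hr; rewrite cl_collinear; last first.
    apply: collinearU1 => // y Hy; case: sN' => _; apply=> //.
    exact: N'H.
  have : generated ((N `&` collinear q) `|` [set r]) `<=` collinear p.
    apply: smallest_sub; first exact: gsubspace_perp.
    move=> y [[Ny _]|->]; first by case: sN => _; apply.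
    by case: sM => _; apply.
  by move=> + gq => /(_ q gq) pq; apply: qp; exact: collinear_sym.
have [k' k'n rMN'] := singular_rank (singularI sM sN'.1).
apply: (IHd N' k') => //; apply: leq_trans kd.
apply: (@singular_rank_lt (M `&` N') (M `&` N) _ _ p) => //.
  exact: singularI sM sN'.1.
by move=> [_ N'p]; apply: qp; case: sN' => _; apply.
Qed.

(** By [pc_disjoint], a dependence of an element of one basis already holds inside that basis. *)
Lemma disjoint_basis M N X Y : singular_subspace M -> singular_subspace N ->
  M `&` N = set0 -> basis cl X M -> basis cl Y N -> basis cl (X `|` Y) (M `|` N).
Proof.
move=> sM sN MN [XM iX MX] [YN iY NY].
have indep S S' A B a : singular_subspace S -> singular_subspace S' ->
    S `&` S' = set0 -> A `<=` S -> B `<=` S' -> independent cl B -> B a ->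
    ~ cl ((A `|` B) `\ a) a.
  move=> sS sS' SS' AS BS' iB Ba cla; apply: (iB a Ba).
  apply: (pc_disjoint clG sS sS' SS' AS).
    by move=> y [/BS'].
  split; first exact: BS'.
  move: cla; apply: (cl_mono clP).
  by move=> y [[Ay|By] ya]; [left|right].
split.
- by move=> y [/XM|/YN]; [left|right].
- move=> a [Xa|Ya]; last exact: indep sM sN MN XM YN iY Ya.
  by rewrite setUC; apply: indep sN sM _ YN XM iX Xa; rewrite setIC.
- move=> y [/MX|/NY]; apply: (cl_mono clP) => z; by [left|right].
Qed.

Lemma opposite_basis M N : maximal_singular M -> maximal_singular N ->
  M `&` N = set0 ->
  exists X, [/\ basis cl X (M `|` N), M `|` N `<=` generated X & X #= `I_(2 * n)].
Proof.
move=> mM mN MN; have [X bX Xn] := maximal_singular_rank mM.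
have [Y bY Yn] := maximal_singular_rank mN.
have genB S B U : singular_subspace S -> basis cl B S -> B `<=` U ->
    S `<=` generated U.
  move=> [_ colS] [BS _ SB] BU; apply: (subset_trans SB); rewrite cl_collinear.
    by apply: smallest_sub; [exact: gsubspace_generated|exact: sub_smallest].
  by move=> x y /BS Sx /BS; exact: colS.
exists (X `|` Y); split.
- by apply: disjoint_basis => //; [case: mM|case: mN].
- move=> x [|].
    by apply: (genB _ _ _ _ bX); [case: mM|left].
  by apply: (genB _ _ _ _ bY); [case: mN|right].
rewrite mul2n -addnn; apply: card_setU_II => //.
rewrite -subset0 -MN => z [Xz Yz].
by split; [case: bX => XM _ _; exact: XM|case: bY => YN _ _; exact: YN].
Qed.

Lemma nice_cl S : nice S -> cl S = S.
Proof.
by move=> nS; apply/seteqP; split; [exact: pc_nice|exact: cl_ext].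
Qed.

(** The subspace generated by [X] is nice because it contains [M] and [N]; nice subspaces are
    closed, so it is the whole closure. *)
Lemma cl_nice M N X : maximal_singular M -> maximal_singular N ->
  M `&` N = set0 -> M `|` N `<=` X -> nice (cl X) /\ generated X = cl X.
Proof.
move=> mM mN MN MNX; have MNgen : M `|` N `<=` generated X.
  by apply: (subset_trans MNX); exact: sub_gen_smallest.
have ngen : nice (generated X).
  split; first exact: gsubspace_generated.
  by exists M, N; split=> // x ?; apply: MNgen; [left|right].
suff genE : generated X = cl X by split=> //; rewrite -genE.
apply/seteqP; split; first exact: generated_cl.
rewrite -(nice_cl ngen); apply: (cl_mono clP); exact: sub_gen_smallest.
Qed.

(** [S] contains a disjoint pair of its own, whose span also has rank [2 * n] and so fills the
    closure of [M] and [N]. *)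
Lemma nice_minimal M N S : maximal_singular M -> maximal_singular N ->
  M `&` N = set0 -> nice S -> S `<=` cl (M `|` N) -> S = cl (M `|` N).
Proof.
move=> mM mN MN nS SMN; apply/seteqP; split=> //.
have [_ [M' [N' [mM' mN' MN' M'S N'S]]]] := nS.
have MNS' : M' `|` N' `<=` S by move=> x [/M'S|/N'S].
have [X [bX _ Xn]] := opposite_basis mM mN MN.
have [X' [bX' _ X'n]] := opposite_basis mM' mN' MN'.
rewrite -(nice_cl nS); apply: (cl_sub clP).
apply: subset_trans (_ : cl (M' `|` N') `<=` _); last exact: (cl_mono clP).
apply: (@has_rank_cl _ _ clP _ _ (2 * n)); [by exists X'|by exists X|].
exact: subset_trans SMN.
Qed.

End PolarSpace.

(** * Well-ordered chains of nice subspaces *)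

Lemma ex_well_order (T : Type) : exists R : T -> T -> Prop,
  [/\ forall x, R x x, forall x y, R x y -> R y x -> x = y,
      forall x y z, R x y -> R y z -> R x z &
      forall A : set T, A !=set0 -> exists2 a, A a & forall b, A b -> R a b].
Proof.
(* [Peq] equips [T] with a decidable equality. *)
elim/Peq: T => T; have [R Rwo] := well_ordering_principle T.
have least (A : set T) : A !=set0 -> exists2 a, A a & forall b, A b -> R a b.
  move=> [a0 Aa0]; have [|a [[aA lba] _]] := Rwo [pred x | `[< A x >]].
    by exists a0; apply/asboolP.
  exists a; first by move/asboolP: aA.
  by move=> b Ab; apply: lba; apply/asboolP.
have refl x : R x x by have [|_ -> /(_ _ erefl)] := least [set x]; first by exists x.
have anti x y : R x y -> R y x -> x = y.
  move=> Rxy Ryx; have [|z [_ zu]] := Rwo (pred2 x y).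
    by exists x; rewrite inE eqxx.
  rewrite -(zu x) ?(zu y)//; split=> [|w /pred2P[]->//]; rewrite ?inE ?eqxx ?orbT//.
exists (fun x y => R x y); split=> // x y z Rxy Ryz.
(* Transitivity is read off from the least element of the triple. *)
have [|a /= Aa lba] := least [set x; y; z]; first by exists x; left; left.
case: Aa lba => [[->|->]|->] lba.
- by apply: lba; right.
- have -> : x = y by apply: anti => //; apply: lba; left; left.
  exact: Ryz.
- have yz : y = z by apply: anti => //; apply: lba; left; right.
  by rewrite -yz.
Qed.

Section NiceChains.
Variables (G : geometry) (n : nat) (cl : set (gpoint G) -> set (gpoint G)).
Hypotheses (polG : polar_space G) (ndG : nondegenerate_geometry G).
Hypotheses (rkG : is_polar_rank G 'I_n) (clG : polar_closure cl).
Implicit Types (A S M N : set (gpoint G)) (C D : set (set (gpoint G))).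
Implicit Types (p q r : gpoint G).

Let clP := pc_pregeometry clG.

Lemma nice_setT : nice [set: gpoint G].
Proof.
have [M [N [mM mN MN]]] := ex_disjoint_maximal_singular polG clG rkG ndG.
by split=> //; exists M, N.
Qed.

Lemma nice_WO_chainU1 C A : nice_WO_chain C -> nice A ->
  (forall S, C S -> S `<=` A \/ A `<=` S) -> nice_WO_chain (C `|` [set A]).
Proof.
move=> [[[S0 CS0] Cnice Ctot] Cwo] nA CA; split; first split.
- by exists S0; left.
- by move=> S [/Cnice|->].
- move=> S S' [CS|->] [CS'|->]; [exact: Ctot|exact: CA| |by left].
  by case: (CA S' CS'); [right|left].
move=> D DCA D0; have [DC0|/set0P DC0] := eqVneq (D `&` C) set0.
  have DA S : D S -> S = A.
    move=> DS; case: (DCA S DS) => // CS.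
    by suff : (D `&` C) S by rewrite DC0.
  by case: D0 => S DS; exists S => // S' DS'; rewrite (DA _ DS) (DA _ DS').
have [|M [DM CM] minM] := Cwo (D `&` C) _ DC0; first by move=> S [].
have [DA|DA] := pselect (D A); last first.
  by exists M => // S DS; case: (DCA S DS) => [CS|SA]; [exact: minM|rewrite SA in DS].
case: (CA M CM) => MA; [exists M|exists A] => // S DS.
  by case: (DCA S DS) => [CS|->//]; exact: minM.
by case: (DCA S DS) => [CS|->//]; apply: (subset_trans MA); exact: minM.
Qed.

Lemma maximal_nice_WO_chain_mem C A : maximal_nice_WO_chain C -> nice A ->
  (forall S, C S -> S `<=` A \/ A `<=` S) -> C A.
Proof.
move=> [woC maxC] nA CA; rewrite -(maxC _ (nice_WO_chainU1 woC nA CA)).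
  by right.
by move=> S; left.
Qed.

(** * Maximal chains from well-orderings of the points *)

Section InitialSegments.
Variables (M N : set (gpoint G)) (R : gpoint G -> gpoint G -> Prop).
Hypotheses (mM : maximal_singular M) (mN : maximal_singular N).
Hypothesis MN : M `&` N = set0.
Hypotheses (Rrefl : forall p, R p p).
Hypotheses (Ranti : forall p q, R p q -> R q p -> p = q).
Hypotheses (Rtrans : forall p q r, R p q -> R q r -> R p r).
Hypothesis Rleast : forall X : set (gpoint G), X !=set0 ->
  exists2 p, X p & forall q, X q -> R p q.

Definition initial_segment (I : set (gpoint G)) := forall p q, R p q -> I q -> I p.

Definition segment_chain :=
  [set cl (M `|` N `|` I) | I in initial_segment].

Let cl_nice' X : nice (cl (M `|` N `|` X)).
Proof. by have [] := cl_nice clG mM mN MN (X := M `|` N `|` X) (@subsetUl _ _ _). Qed.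

(** Unless all the segments are full, take the least point missed by any of them: a segment that
    misses it is contained in all the others. *)
Lemma segment_chain_least D : D `<=` segment_chain -> D !=set0 ->
  exists2 S, D S & forall S', D S' -> S `<=` S'.
Proof.
move=> Dseg [S0 DS0].
pose J := [set I | initial_segment I /\ D (cl (M `|` N `|` I))].
have DJ S : D S -> exists2 I, J I & S = cl (M `|` N `|` I).
  by move=> DS; have [I segI IS] := Dseg S DS; exists I => //; split=> //; rewrite IS.
have [all|] := pselect (forall I, J I -> I = setT).
  exists S0 => // S /DJ[I /all -> ->].
  by have [I0 /all -> ->] := DJ _ DS0.
move=> /existsNP[I1 /not_implyP[JI1 I1T]].
have [|p [I JI Ip] leastp] := Rleast (X := [set p | exists2 I, J I & ~ I p]).
  have /existsNP[p I1p] : ~ (forall p, I1 p).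
    by move=> all; apply: I1T; apply/seteqP; split.
  by exists p, I1.
exists (cl (M `|` N `|` I)); first by case: JI.
move=> _ /DJ[I' JI' ->]; apply: (cl_mono clP) => q [?|Iq]; first by left.
right; apply: contrapT => I'q; apply: Ip; case: JI => segI _.
by apply: (segI p q) => //; apply: leastp; exists I'.
Qed.

Lemma segment_chain_nice_WO : nice_WO_chain segment_chain.
Proof.
split; last exact: segment_chain_least.
split.
- by exists (cl (M `|` N `|` set0)), set0 => // p q.
- by move=> _ [I _ <-]; exact: cl_nice'.
- move=> S S' CS CS'.
  have [_ [->|->] least] := @segment_chain_least [set S; S']
      (fun _ => ltac:(by move=> [->|->])) (ex_intro _ S (or_introl erefl)).
    by left; apply: least; right.
  by right; apply: least; left.
Qed.

(** Let [A] belong to a larger chain, [I] be the largest initial segment inside [A], and [p] the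
    least point outside [I]. Then [p] is not in [A], so [A] lies between the closures given by [I]
    and by [I] with [p]; exchange leaves no room between them. *)
Lemma segment_chain_maximal : maximal_nice_WO_chain segment_chain.
Proof.
split; first exact: segment_chain_nice_WO.
move=> C [[_ Cnice Ctot] _] segC; apply/seteqP; split=> // A CA.
have C0 : C (cl (M `|` N)).
  by apply: segC; exists set0; [move=> p q|rewrite setU0].
have seg0 : segment_chain (cl (M `|` N)).
  by exists set0; [move=> p q|rewrite setU0].
case: (Ctot _ _ CA C0) => [AMN|MNA].
  by rewrite (nice_minimal polG clG rkG mM mN MN (Cnice _ CA) AMN).
have {}MNA : M `|` N `<=` A by apply: subset_trans MNA; exact: cl_ext.
pose I := [set q | forall r, R r q -> A r].
have segI : initial_segment I.
  by move=> p q pq Iq r rp; apply: Iq; exact: Rtrans pq.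
have IA : cl (M `|` N `|` I) `<=` A.
  rewrite -[X in _ `<=` X](nice_cl clG (Cnice _ CA)); apply: (cl_mono clP).
  by move=> q [/MNA|/(_ q (Rrefl q))].
have [IT|] := pselect (forall q, I q).
  exists I => //; apply/seteqP; split=> // q _.
  by apply: (cl_ext clP); right.
move=> /existsNP[q0 Iq0]; have [|p Ip leastp] := Rleast (X := ~` I); first by exists q0.
have belowp r : R r p -> I r \/ r = p.
  move=> rp; have [|Ir] := pselect (I r); first by left.
  by right; apply: Ranti => //; exact: leastp.
have Ap : ~ A p.
  move=> Ap; apply: Ip => r /belowp[|->//].
  exact.
have segIp : initial_segment (I `|` [set p]).
  move=> r q rq [Iq|qp]; first by left; exact: segI Iq.
  by rewrite qp in rq; case: (belowp r rq); [left|right].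
have CIp : C (cl (M `|` N `|` (I `|` [set p]))).
  by apply: segC; exists (I `|` [set p]).
case: (Ctot _ _ CA CIp) => [AIp|IpA]; last first.
  by case: Ap; apply: IpA; apply: (cl_ext clP); right; right.
exists I => //; apply/seteqP; split=> // a Aa; apply: contrapT => Ia.
(* Exchanging [p] for a point [a] of [A] outside the smaller closure would put [p] in [A]. *)
have := AIp a Aa; rewrite setUA => /(cl_exchange clP) /(_ Ia) Iap.
apply: Ap; rewrite -(nice_cl clG (Cnice _ CA)).
apply: (cl_mono clP) Iap => y [MNIy|->//].
by apply: IA; exact: cl_ext.
Qed.

End InitialSegments.

(* Order the points lexicographically, first by the least member of the chain
   containing them and then by an arbitrary well-ordering: the members of the
   chain become initial segments. *)
Lemma ex_maximal_nice_WO_chain C : nice_WO_chain C ->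
  exists2 M : set (set (gpoint G)), maximal_nice_WO_chain M & C `<=` M.
Proof.
(* The whole space is added so that every point lies in some member and thus has a level [lev]. *)
move=> woC; pose C1 := C `|` [set setT].
have woC1 : nice_WO_chain C1.
  by apply: (nice_WO_chainU1 woC nice_setT) => S _; left.
have [[C1n C1nice C1tot] C1wo] := woC1.
have C1T : C1 setT by right.
have [S0 C1S0 leastS0] := C1wo C1 (fun _ => id) C1n.
have [_ [M [N [mM mN MN MS0 NS0]]]] := C1nice _ C1S0.
have [R [Rrefl Ranti Rtrans Rleast]] := ex_well_order (gpoint G).
have /choice[lev levP] p : exists L,
    [/\ C1 L, L p & forall S, C1 S -> S p -> L `<=` S].
  have [||L [C1L Lp] leastL] := C1wo [set S | C1 S /\ S p].
  - by move=> S [].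
  - by exists setT.
  - by exists L; split=> // S C1S Sp; exact: leastL.
pose le p q := lev p `<=` lev q /\ (lev p = lev q -> R p q).
have le_anti p q : le p q -> le q p -> p = q.
  move=> [pq Rpq] [qp Rqp]; have e : lev p = lev q by apply/seteqP.
  by apply: Ranti; [exact: Rpq|exact: Rqp].
have le_trans p q r : le p q -> le q r -> le p r.
  move=> [pq Rpq] [qr Rqr]; split=> [|e]; first exact: subset_trans qr.
  have qp : lev p = lev q by apply/seteqP; split=> //; rewrite e.
  by apply: Rtrans (Rpq qp) _; apply: Rqr; rewrite -qp.
have le_least X : X !=set0 -> exists2 p, X p & forall q, X q -> le p q.
  move=> [p0 Xp0].
  have [||L [p1 Xp1 <-] leastL] := C1wo (lev @` X).
  - by move=> _ [p _ <-]; case: (levP p).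
  - by exists (lev p0), p0.
  have [|p [Xp pL] leastp] := Rleast [set p | X p /\ lev p = lev p1]; first by exists p1.
  exists p => // q Xq; split; first by rewrite pL; apply: leastL; exists q.
  by move=> pq; apply: leastp; split=> //; rewrite -pq.
exists (segment_chain M N le).
  apply: (segment_chain_maximal mM mN MN) le_anti le_trans le_least => p.
  by split.
move=> S CS; have C1S : C1 S by left.
exists S.
  move=> p q [pq _] Sq; have [_ lpp _] := levP p; have [_ _ leastq] := levP q.
  by apply: (leastq S C1S Sq); exact: pq.
(* [S] is closed and contains the least member, hence [M] and [N], so it is the closure attached to
   the segment [S]. *)
rewrite -[RHS](nice_cl clG (C1nice _ C1S)); congr cl.
apply/seteqP; split=> [p [[/MS0|/NS0]|//]|]; last by right.
  exact: leastS0.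
exact: leastS0.
Qed.

(** * The common length of the maximal chains *)

Section Length.
Variables X0 B0 : set (gpoint G).
Hypotheses (X0n : X0 #= `I_(2 * n)) (XB0 : X0 `&` B0 = set0).
Hypothesis basis0 : basis cl (X0 `|` B0) setT.

Lemma maximal_nice_WO_chain_top C : maximal_nice_WO_chain C -> C setT.
Proof.
by move=> maxC; apply: (maximal_nice_WO_chain_mem maxC nice_setT); left.
Qed.

(** The chosen points [B], added to a basis [X] of a disjoint pair in the least member, form a basis
    of the whole space. Comparing it with the given basis and cancelling [2 * n] elements on each
    side gives the result. *)
Lemma maximal_nice_WO_chain_card C : maximal_nice_WO_chain C ->
  B0 #= C `\ setT.
Proof.
move=> maxC; have [[[C0 Cnice Ctot] Cwo] _] := maxC.
have CT := maximal_nice_WO_chain_top maxC.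
have memC := maximal_nice_WO_chain_mem maxC.
have [S0 CS0 leastS0] := Cwo C (fun _ => id) C0.
have [_ [M [N [mM mN MN MS0 NS0]]]] := Cnice _ CS0.
have MNS S : C S -> M `|` N `<=` S.
  by move=> CS x [/MS0|/NS0] ?; apply: (leastS0 S CS).
have [X [[XMN iX MNX] _ Xn]] := opposite_basis polG clG rkG mM mN MN.
have clC S : C S -> cl S = S by move=> /Cnice; exact: nice_cl.
have cl_niceU Y : M `|` N `<=` Y -> nice (cl Y).
  by move=> MNY; case: (cl_nice clG mM mN MN MNY).
(* [pt S] lies in the successor of [S] but not in [S]. *)
have [p0 _] := point_nonempty G.
have /choice[pt ptP] S : exists p, (C `\ setT) S ->
    ~ S p /\ forall S', C S' -> ~ (S' `<=` S) -> S' p.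
  have [[CS ST]|] := pselect ((C `\ setT) S); last by exists p0.
  have [||S' [CS' S'S] leastS'] := Cwo [set S' | C S' /\ ~ (S' `<=` S)].
  - by move=> S' [].
  - by exists setT; split=> // TS; apply: ST; apply/seteqP; split.
  move/existsNP: S'S => [p /not_implyP[S'p Sp]].
  by exists p => _; split=> // T CT' TS; apply: (leastS' T).
have ptN S : (C `\ setT) S -> ~ S (pt S) by case/ptP.
have ptS S S' : (C `\ setT) S -> C S' -> ~ (S' `<=` S) -> S' (pt S).
  by move=> /ptP[_]; apply.
pose B := pt @` (C `\ setT).
have pt_sub S S' : (C `\ setT) S -> (C `\ setT) S' -> pt S = pt S' -> S `<=` S'.
  move=> CS CS' e; apply: contrapT => SS'; apply: (ptN _ CS); rewrite e.
  exact: ptS CS' CS.1 SS'.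
have ptI S S' : (C `\ setT) S -> (C `\ setT) S' -> pt S = pt S' -> S = S'.
  by move=> CS CS' e; apply/seteqP; split; exact: pt_sub.
have BC : B #= C `\ setT.
  by apply: inj_card_eq => S S' /set_mem CS /set_mem CS'; exact: ptI.
have XB : X `&` B = set0.
  rewrite -subset0 => x [Xx [S CS Sx]]; apply: (ptN _ CS).
  by rewrite Sx; apply: (MNS S CS.1); exact: XMN.
(* [J W] collects [X] and the points chosen at members that do not contain [W]; its independence is
   proved by least counterexample along the chain. *)
pose J W := X `|` pt @` [set S | (C `\ setT) S /\ ~ (W `<=` S)].
have JW W : C W -> J W `<=` W.
  move=> CW x [/XMN/(MNS _ CW)//|[S [CS WS] <-]].
  exact: ptS.
have iJ W : C W -> independent cl (J W).
  move=> CW; apply: contrapT => nW.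
  have [||V [CV nV] leastV] := Cwo [set W | C W /\ ~ independent cl (J W)].
  - by move=> ? [].
  - by exists W.
  apply: nV.
  (* [Q S] also includes the point chosen at [S]. These sets increase to the chosen part of [J V],
     and each lies in [J S] with [pt S] added. *)
  pose Q S := pt @` [set S' | (C `\ setT) S' /\ S' `<=` S].
  have -> : J V = X `|` \bigcup_(Y in
      Q @` [set S | (C `\ setT) S /\ ~ (V `<=` S)]) Y.
    rewrite /J; congr (_ `|` _); apply/seteqP; split.
      move=> _ [S [CS VS] <-]; exists (Q S); first by exists S.
      by exists S => //; split.
    move=> _ [_ [S [CS VS] <-] [S' [CS' S'S] <-]]; exists S' => //; split=> //.
    by move=> VS'; apply: VS; exact: subset_trans S'S.
  apply: (independent_bigcup clP iX).
    move=> _ _ [S [[CS _] _] <-] [S' [[CS' _] _] <-].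
    by case: (Ctot _ _ CS CS') => SS'; [left|right] => _ [T [CT' TS] <-];
      exists T => //; split=> //; exact: subset_trans SS'.
  move=> _ [S [CS VS] <-].
  have iJS : independent cl (J S).
    apply: contrapT => nS; apply: VS; apply: leastV; split=> //.
    by case: CS.
  have JSpt : ~ cl (J S) (pt S).
    by move=> /(cl_mono clP (JW S CS.1)); rewrite clC; [exact: ptN|case: CS].
  apply: (independent_sub clP _ (independentU1 clP iJS JSpt)).
  move=> x [Xx|[S' [CS' S'S] <-]]; first by left; left.
  have [SS'|SS'] := pselect (S `<=` S'); last by left; right; exists S'.
  by right; congr pt; apply/seteqP.
have iXB : independent cl (X `|` B).
  apply: (independent_sub clP _ (iJ _ CT)) => x [Xx|[S CS <-]]; [by left|right].
  exists S => //; split=> // TS; case: CS => _; apply.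
  by apply/seteqP; split.
(* By maximality, the least member [A] outside the span is generated by the
   union [W0] of the smaller members and at most one further point. *)
have MNclXB : M `|` N `<=` cl (X `|` B).
  by apply: (subset_trans MNX); apply: (cl_mono clP); left.
have spanXB W : C W -> W `<=` cl (X `|` B).
  move=> CW; apply: contrapT => nW.
  have [||A [CA nA] leastA] := Cwo [set W | C W /\ ~ (W `<=` cl (X `|` B))].
  - by move=> ? [].
  - by exists W.
  have ltA S : C S -> ~ (A `<=` S) -> S `<=` cl (X `|` B).
    by move=> CS AS; apply: contrapT => nS; apply: AS; exact: leastA.
  pose W0 := cl (M `|` N `|` \bigcup_(S in [set S | C S /\ ~ (A `<=` S)]) S).
  have W0XB : W0 `<=` cl (X `|` B).
    by apply: (cl_sub clP) => x [/MNclXB//|[S [CS /(ltA _ CS) SXB] /SXB]].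
  have W0A : W0 `<=` A.
    rewrite -(clC A CA); apply: (cl_mono clP) => x [/(MNS _ CA)//|[S [CS AS] Sx]].
    by case: (Ctot _ _ CS CA) => [|//]; apply.
  have cmpA S : C S -> S `<=` W0 \/ A `<=` S.
    move=> CS; have [AS|AS] := pselect (A `<=` S); [by right|left].
    by move=> x Sx; apply: (cl_ext clP); right; exists S.
  (* [W0] contains every member that does not contain [A] and lies in all the others, so maximality
     puts it in [C]; the same holds for [W1] below. *)
  have CW0 : C W0.
    apply: memC; first by apply: cl_niceU; left.
    by move=> S /cmpA[|AS]; [left|right; exact: subset_trans AS].
  have AW0 : ~ (A `<=` W0) by move=> AW; apply: nA; exact: subset_trans W0XB.
  have CTW0 : (C `\ setT) W0 by split=> // W0T; apply: AW0; rewrite W0T.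
  have ApW : A (pt W0) by exact: ptS.
  pose W1 := cl (W0 `|` [set pt W0]).
  have W1A : W1 `<=` A.
    by rewrite -(clC A CA); apply: (cl_mono clP) => x [/W0A|->].
  have W01 : W0 `<=` W1 by move=> x W0x; apply: (cl_ext clP); left.
  have CW1 : C W1.
    apply: memC.
      by apply: cl_niceU => x /(MNS _ CW0) ?; left.
    move=> S /cmpA[SW0|AS]; [left|right; exact: subset_trans AS].
    exact: subset_trans W01.
  have AW1 : A `<=` W1.
    case: (cmpA _ CW1) => // W10; case: (ptN _ CTW0).
    by apply: W10; apply: (cl_ext clP); right.
  apply: nA; apply: (subset_trans AW1); apply: (cl_sub clP) => x [/W0XB//|->].
  by apply: (cl_ext clP); right; exists W0.
have bXB : basis cl (X `|` B) setT by split=> //; exact: spanXB.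
rewrite -(card_eqr BC) card_eq_le.
have := basis_card_eq clP basis0 bXB; rewrite card_eq_le => /andP[le1 le2].
by rewrite (card_leU_inv X0n Xn XB0 le1) (card_leU_inv Xn X0n XB le2).
Qed.

(** The top member supplies the extra element of [option B0]; for an infinite chain, removing it
    does not change the cardinality. *)
Lemma maximal_nice_WO_chain_length C : maximal_nice_WO_chain C ->
  is_chain_length C B0.
Proof.
move=> maxC; have BC := maximal_nice_WO_chain_card maxC.
have CT := maximal_nice_WO_chain_top maxC.
have optC : [set: option B0] #= C by exact: card_option_setD1 CT BC.
have [finC|infC] := pselect (finite_set C); [by left|right; split=> //].
rewrite (card_eql (card_setT B0)) (card_eql BC) card_eq_le.
by rewrite card_infinite_setD1// subset_card_le// => S [].
Qed.

End Length.

End NiceChains.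

(** * Equality of the two coranks *)

Theorem theorem4p8 (G : geometry) (n : nat)
    (polG : polar_space G) (ndG : nondegenerate_geometry G)
    (rkG : is_polar_rank G 'I_n) (n_ge2 : (2 <= n)%N)
    (thickG : thick_lines G) (embG : admits_faithful_embedding G) :
  exists crk : Type,
    [/\ is_polar_corank G crk,
        is_corank_WO G crk,
        forall C : set (set (gpoint G)), nice_WO_chain C ->
          exists2 M : set (set (gpoint G)), maximal_nice_WO_chain M & C `<=` M &
        forall M : set (set (gpoint G)), maximal_nice_WO_chain M ->
          is_chain_length M crk].
Proof.
have [cl clG] := faithful_polar_closure embG.
have clP := pc_pregeometry clG.
have [M [N [mM mN MN]]] := ex_disjoint_maximal_singular polG clG rkG ndG.
have [X [[_ iX _] MNX Xn]] := opposite_basis polG clG rkG mM mN MN.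
have [Z bZ XZ] := basis_extension clP iX (@subsetT _ X).
have [_ iZ ZT] := bZ.
(* [B] represents the corank: [X] accounts for the [2 * n] elements that the corank leaves out. *)
pose B := Z `\` X; have XB : X `&` B = set0 by rewrite setDIK.
have XBZ : X `|` B = Z by rewrite setDUK.
have bXB : basis cl (X `|` B) setT by rewrite XBZ.
have lenM := maximal_nice_WO_chain_length polG ndG rkG clG Xn XB bXB.
have extC := @ex_maximal_nice_WO_chain _ _ _ polG ndG rkG clG.
exists B; split=> //.
  exists n; split=> //; split.
    exists (X `|` B); split; last exact: card_sum_setU.
    (* [cl_nice] is applied to the subspace generated by [Z], since [Z] itself need not contain [M]
       and [N]. *)
    rewrite XBZ; have MNZ : M `|` N `<=` generated Z.
      apply: (subset_trans MNX); apply: smallest_sub; first exact: gsubspace_generated.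
      exact: sub_smallest.
    have [_ genE] := cl_nice clG mM mN MN MNZ.
    have genK : generated (generated Z) = generated Z.
      by apply: smallest_id; exact: gsubspace_generated.
    rewrite -genK genE; apply/seteqP; split=> //; apply: (subset_trans ZT).
    by apply: (cl_mono clP); exact: sub_gen_smallest.
  move=> Y YT; rewrite (card_le_eql (card_sum_setU XB Xn)) XBZ.
  apply: (independent_card_le clP iZ) => x _; apply: (generated_cl clG).
  by rewrite YT.
split=> [alpha [C [woC lenC]]|beta ub].
  (* Upper bound: [C] is compared with a maximal chain [D] containing it, and [D] without its top
     has the size of [B]. *)
  have [D maxD CD] := extC C woC.
  have BD := maximal_nice_WO_chain_card polG ndG rkG clG Xn XB bXB maxD.
  have optD : [set: option B] #= D.
    exact: card_option_setD1 (maximal_nice_WO_chain_top polG ndG rkG clG maxD) BD.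
  case: lenC => [[_ aC]|[infC aC]].
    apply: card_le_option; rewrite (card_le_eql aC) (card_le_eqr optD).
    exact: subset_card_le.
  rewrite (card_le_eql aC) (card_le_eqr (card_setT B)) (card_le_eqr BD).
  apply: card_le_trans (subset_card_le CD) _; apply: card_infinite_setD1.
  by move=> /(sub_finite_set CD).
(* The supremum is attained: some maximal chain exists, and its length is [B]. *)
have [|D maxD _] := extC [set setT].
  split; first split.
  - by exists setT.
  - by move=> _ ->; exact: nice_setT polG ndG rkG clG.
  - by move=> _ _ -> ->; left.
  - by move=> D DT [S DS]; exists S => // S' /DT ->; rewrite (DT _ DS).
by apply: ub; exists D; split; [case: maxD|exact: lenM].
Qed.
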